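(* Let $(\rho_n)_{n\geqslant 0}$ be a sequence of non-zero numbers with $\rho_0=1$, and let $(K_m(x))_{m\geqslant 0}$ be a sequence of polynomials in $x$. For $n\geqslant 1$ let $F_n(x)=\det H_n(x)$, where $H_n(x)=(h_{ij})_{1\leqslant i,j\leqslant n}$ is the matrix with $$h_{ij}=\begin{cases}\dfrac{\rho_i}{\rho_{j-1}\rho_{i-j+1}}K_{i-j}(x), & 1\leqslant j\leqslant i,\\ -1, & j=i+1,\\ 0, & j>i+1.\end{cases}$$ Let $F(x;z)=1+\sum_{n\geqslant 1}F_n(x)\frac{z^n}{\rho_n}$. Then $$F(x;z)=\frac{1}{1-K(x;z)},\qquad\text{where } K(x;z)=\sum_{m\geqslant0}K_m(x)\frac{z^{m+1}}{\rho_{m+1}}.$$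
   Context: Generating functions are formal power series in $z$ whose coefficients are polynomials in $x$. *)

(* Defs.v *)
From HB Require Import structures.
From mathcomp Require Import all_boot all_order all_algebra.
From mathcomp Require Import boolp.

Set Implicit Arguments.
Unset Strict Implicit.
Unset Printing Implicit Defensive.

Import GRing.Theory.
Local Open Scope ring_scope.

(* [Fps a] is the formal power series \sum_(n >= 0) a n * z ^ n.  A record is
   used rather than the bare function type [nat -> A] so that the ring
   structure is the Cauchy product and not the pointwise product. *)
Record fps (A : Type) := Fps { coef_fps : nat -> A }.

HB.instance Definition _ (A : Type) := gen_eqMixin (fps A).
HB.instance Definition _ (A : Type) := gen_choiceMixin (fps A).

Lemma fpsP (A : Type) (f g : fps A) : coef_fps f =1 coef_fps g -> f = g.
Proof. by case: f g => [f] [g] /= /funext ->. Qed.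

Section FpsZmod.
Variable A : zmodType.
Implicit Types f g h : fps A.

Definition fps_zero : fps A := Fps (fun=> 0).
Definition fps_opp f := Fps (fun n => - coef_fps f n).
Definition fps_add f g := Fps (fun n => coef_fps f n + coef_fps g n).

Fact fps_addA : associative fps_add.
Proof. by move=> f g h; apply: fpsP => n /=; rewrite addrA. Qed.
Fact fps_addC : commutative fps_add.
Proof. by move=> f g; apply: fpsP => n /=; rewrite addrC. Qed.
Fact fps_add0 : left_id fps_zero fps_add.
Proof. by move=> f; apply: fpsP => n /=; rewrite add0r. Qed.
Fact fps_addN : left_inverse fps_zero fps_opp fps_add.
Proof. by move=> f; apply: fpsP => n /=; rewrite addNr. Qed.

HB.instance Definition _ :=
  GRing.isZmodule.Build (fps A) fps_addA fps_addC fps_add0 fps_addN.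

Lemma coef_fps0 n : coef_fps (0 : fps A) n = 0.
Proof. by []. Qed.
Lemma coef_fpsN f n : coef_fps (- f) n = - coef_fps f n.
Proof. by []. Qed.
Lemma coef_fpsD f g n : coef_fps (f + g) n = coef_fps f n + coef_fps g n.
Proof. by []. Qed.
End FpsZmod.

Section FpsRing.
Variable A : comNzRingType.
Implicit Types f g h : fps A.

Definition fps_one : fps A := Fps (fun n => (n == 0%N)%:R).
Definition fps_mul f g : fps A :=
  Fps (fun n => \sum_(i < n.+1) coef_fps f i * coef_fps g (n - i)).

(* The ring axioms are inherited from {poly A} by truncation. *)
Let trunc N f : {poly A} := \poly_(i < N.+1) coef_fps f i.

Let coef_trunc N f n : (n <= N)%N -> (trunc N f)`_n = coef_fps f n.
Proof. by move=> nN; rewrite coef_poly ltnS nN. Qed.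

Let fps_mulE N f g n (p q : {poly A}) : (n <= N)%N ->
  (forall i, (i <= N)%N -> p`_i = coef_fps f i) ->
  (forall i, (i <= N)%N -> q`_i = coef_fps g i) ->
  coef_fps (fps_mul f g) n = (p * q)`_n.
Proof.
move=> nN Hp Hq; rewrite coefM /=; apply: eq_bigr => i _.
rewrite Hp ?Hq //; first exact: leq_trans (leq_subr _ _) nN.
by apply: leq_trans nN; rewrite -ltnS.
Qed.

Fact fps_mulA : associative fps_mul.
Proof.
move=> f g h; apply: fpsP => n.
have T k : forall i, (i <= n)%N -> (trunc n k)`_i = coef_fps k i.
  by move=> i; apply: coef_trunc.
rewrite (fps_mulE (leqnn n) (T f) (q := trunc n g * trunc n h)); last first.
  by move=> i le_in; rewrite (fps_mulE le_in (T g) (T h)).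
rewrite (fps_mulE (leqnn n) (p := trunc n f * trunc n g) _ (T h)) ?mulrA //.
by move=> i le_in; rewrite (fps_mulE le_in (T f) (T g)).
Qed.

Fact fps_mulC : commutative fps_mul.
Proof.
move=> f g; apply: fpsP => n.
have T k : forall i, (i <= n)%N -> (trunc n k)`_i = coef_fps k i.
  by move=> i; apply: coef_trunc.
by rewrite (fps_mulE (leqnn n) (T f) (T g)) mulrC -(fps_mulE (leqnn n) (T g) (T f)).
Qed.

Fact fps_mul1 : left_id fps_one fps_mul.
Proof.
move=> f; apply: fpsP => n /=.
rewrite big_ord_recl /= subn0 mul1r big1 ?addr0 // => i _.
by rewrite mul0r.
Qed.

Fact fps_mulD : left_distributive fps_mul +%R.
Proof.
move=> f g h; apply: fpsP => n /=.
by rewrite -big_split; apply: eq_bigr => i _; rewrite mulrDl.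
Qed.

Fact fps_oner_neq0 : fps_one != 0.
Proof.
apply/eqP => /(congr1 (fun f : fps A => coef_fps f 0%N)) /= /eqP.
by rewrite oner_eq0.
Qed.

HB.instance Definition _ := GRing.Zmodule_isComNzRing.Build (fps A)
  fps_mulA fps_mulC fps_mul1 fps_mulD fps_oner_neq0.

Lemma coef_fps1 n : coef_fps (1 : fps A) n = (n == 0%N)%:R.
Proof. by []. Qed.
Lemma coef_fpsM f g n :
  coef_fps (f * g) n = \sum_(i < n.+1) coef_fps f i * coef_fps g (n - i).
Proof. by []. Qed.

Definition fps_unit : {pred fps A} := fun f => `[< exists g, g * f = 1 >].

(* As for every MathComp unit ring, the inverse of a non-unit is itself. *)
Definition fps_inv f : fps A :=
  if pselect (exists g, g * f = 1) is left ex_g then sval (cid ex_g) else f.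

Fact fps_mulV : {in fps_unit, left_inverse 1 fps_inv *%R}.
Proof.
move=> f /asboolP uf; rewrite /fps_inv.
by case: pselect => // ex_g; case: cid.
Qed.
Fact fps_unitP f g : g * f = 1 -> fps_unit f.
Proof. by move=> gf1; apply/asboolP; exists g. Qed.
Fact fps_inv_out : {in [predC fps_unit], fps_inv =1 id}.
Proof.
move=> f /negP Nuf; rewrite /fps_inv.
by case: pselect => // ex_g; case: Nuf; apply/asboolP.
Qed.

HB.instance Definition _ := GRing.ComNzRing_hasMulInverse.Build (fps A)
  fps_mulV fps_unitP fps_inv_out.
End FpsRing.

Section HessenbergDeterminants.
Variables (k : fieldType) (rho : nat -> k) (K : nat -> {poly k}).

(* The indices i and j are counted from 1. *)
Definition hess_entry (i j : nat) : {poly k} :=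
  if (j <= i)%N then
    (rho i / (rho (j - 1)%N * rho (i - j + 1)%N)) *: K (i - j)%N
  else if j == i.+1 then -1
  else 0.

Definition hess_mx (n : nat) : 'M[{poly k}]_n :=
  \matrix_(i < n, j < n) hess_entry i.+1 j.+1.

Definition hess_det (n : nat) : {poly k} := \det (hess_mx n).

(* 1 + \sum_(n >= 1) F_n(x) z^n / rho_n *)
Definition genF : fps {poly k} :=
  1 + Fps (fun n => if n is 0 then 0 else (rho n)^-1 *: hess_det n).

(* \sum_(m >= 0) K_m(x) z^(m+1) / rho_(m+1) *)
Definition genK : fps {poly k} :=
  Fps (fun n => if n is m.+1 then (rho m.+1)^-1 *: K m else 0).
End HessenbergDeterminants.

(* Main.v *)
(* Write D_n for the determinant of the leading n x n block of a lower
   Hessenberg matrix with superdiagonal -1.  Replacing the first column of the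
   block of size n + 1 by its product with (D_0, ..., D_n) does not change the
   determinant, since D_0 = 1; inductively this product vanishes in all rows but
   the last, which yields D_{n+1} = \sum_j a_{n,j} D_j.  For H_n, dividing by
   rho_n turns this recurrence into F = 1 + F K, coefficient by coefficient. *)
Require Import Defs.
From mathcomp Require Import all_boot all_order all_algebra.

Import GRing.Theory.
Local Open Scope ring_scope.

Lemma det_hessenberg_rec (R : comNzRingType) (a : nat -> nat -> R) (n : nat) :
    (forall i, a i i.+1 = -1) ->
    (forall i j, (i.+1 < j)%N -> a i j = 0) ->
  \det (\matrix_(i < n.+1, j < n.+1) a i j) =
    \sum_(j < n.+1) a n j * \det (\matrix_(i < j, l < j) a i l).
Proof.
move=> a_super a_upper.
pose H m : 'M[R]_m := \matrix_(i < m, j < m) a i j.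
rewrite -/(H n.+1) -[RHS]/(\sum_(j < n.+1) a n j * \det (H j)).
elim/ltn_ind: n => n IHn.
(* [U] is the identity with first column [\det (H i)], so right multiplication by [U] changes only
   the first column. *)
pose U : 'M[R]_n.+1 :=
  \matrix_(i, j) if j == 0 then \det (H i) else (i == j)%:R.
have detU : \det U = 1.
  rewrite det_trig; last first.
    apply/is_trig_mxP => i j lt_ij; rewrite mxE; case: eqP => [j0|_].
      by rewrite j0 in lt_ij.
    by case: eqP lt_ij => // ->; rewrite ltnn.
  apply: big1 => i _; rewrite mxE eqxx; case: eqP => // ->.
  by rewrite det_mx00.
have HU0 i : (H n.+1 *m U) i 0 = \sum_(j < n.+1) a i j * \det (H j).
  by rewrite mxE; apply: eq_bigr => j _; rewrite !mxE eqxx.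
have HUS i j : (H n.+1 *m U) i (lift 0 j) = a i (lift 0 j).
  rewrite mxE (bigD1 (lift 0 j)) //= !mxE eqxx mulr1 big1 ?addr0 // => l ne_lj.
  by rewrite !mxE (negPf ne_lj) mulr0.
have HU0_lt i : i != ord_max -> (H n.+1 *m U) i 0 = 0.
  move=> ne_i; have lt_in : (i < n)%N.
    by rewrite ltn_neqAle -ltnS ltn_ord andbT; apply: contraNneq ne_i => e;
       apply/eqP/val_inj.
  rewrite HU0 -(big_mkord predT (fun j => a i j * \det (H j))).
  (* By induction the terms [j <= i] sum to [\det (H i.+1)]; the term [j = i.+1] is its opposite,
     and all later ones vanish. *)
  rewrite (big_cat_nat (n := i.+2)) //= big_nat_recr //= big_mkord -IHn //.
  rewrite a_super mulN1r subrr add0r big_nat big1 // => j /andP[lt_ij _].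
  by rewrite a_upper // mul0r.
rewrite -[LHS]mulr1 -detU -det_mulmx (expand_det_col _ 0).
rewrite (bigD1 ord_max) //= big1 ?addr0 => [|i /HU0_lt->]; last by rewrite mul0r.
(* Without its last row and first column the product is lower triangular with diagonal [-1]; this
   determinant [(-1) ^+ n] cancels the cofactor sign. *)
rewrite HU0 /cofactor det_trig; last first.
  apply/is_trig_mxP => i j lt_ij; rewrite 2!mxE HUS a_upper //.
  by rewrite lift_max lift0.
under [X in _ * (_ * X)]eq_bigr => i _ do
  rewrite 2!mxE HUS lift_max lift0 a_super.
by rewrite prodr_const card_ord addn0 -exprD addnn -signr_odd odd_double mulr1.
Qed.

Lemma hess_det_rec (k : fieldType) (rho : nat -> k) (K : nat -> {poly k}) n :
  hess_det rho K n.+1 = \sum_(j < n.+1)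
    (rho n.+1 / (rho j * rho (n - j).+1)) *: (K (n - j)%N * hess_det rho K j).
Proof.
rewrite /hess_det /hess_mx.
rewrite (det_hessenberg_rec _ (fun i j => hess_entry rho K i.+1 j.+1)).
- apply: eq_bigr => j _.
  by rewrite /hess_entry ltn_ord subn1 subSS addn1 scalerAl.
- by move=> i; rewrite /hess_entry ltnn eqxx.
- move=> i j lt_ij; rewrite /hess_entry ltnS leqNgt (ltnW lt_ij) /=.
  by rewrite eqSS gtn_eqF.
Qed.

(** Absorbs the separate constant term 1 into the general formula: the empty determinant and [rho 0]
    are both 1. *)
Lemma coef_genF (k : fieldType) (rho : nat -> k) (K : nat -> {poly k}) n :
  rho 0%N = 1 -> coef_fps (genF rho K) n = (rho n)^-1 *: hess_det rho K n.
Proof.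
move=> rho0; case: n => [|n]; rewrite coef_fpsD coef_fps1 /= ?add0r //.
by rewrite addr0 rho0 invr1 scale1r /hess_det det_mx00.
Qed.

Theorem lemma2p2 (k : fieldType) (rho : nat -> k) (K : nat -> {poly k})
    (rho_neq0 : forall n : nat, rho n != 0) (rho0 : rho 0%N = 1) :
  1 - genK rho K \is a GRing.unit /\ genF rho K = 1 / (1 - genK rho K).
Proof.
have genF_fix : genF rho K = 1 + genF rho K * genK rho K.
  apply: fpsP => -[|n]; rewrite [RHS]coef_fpsD coef_fps1 coef_fpsM.
    by rewrite big_ord1 mulr0.
  (* The last term of the Cauchy product vanishes because [genK] has no constant term. *)
  rewrite add0r coef_genF // big_ord_recr [X in _ = _ + X](_ : _ = 0);
    last by rewrite /= subnn mulr0.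
  rewrite [RHS]addr0 hess_det_rec.
  rewrite scaler_sumr; apply: eq_bigr => j _.
  have le_jn : (j <= n)%N by rewrite -ltnS.
  rewrite scalerA mulKf // coef_genF //.
  rewrite [(n.+1 - _)%N](subSn le_jn) -scalerAl -scalerAr scalerA.
  by rewrite -invfM [K _ * _]mulrC.
have genFM : genF rho K * (1 - genK rho K) = 1.
  by rewrite mulrBr mulr1 {1}genF_fix addrK.
have unitK : 1 - genK rho K \is a GRing.unit.
  by apply/unitrPr; exists (genF rho K); rewrite mulrC.
by split=> //; apply: (mulIr unitK); rewrite genFM divrK.
Qed.
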